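(* For each $\mathbf{SUB}\in\{\mathbf{NFL},\mathbf{FL},\mathbf{BCI},\mathbf{BCK},\mathbf{BCW}\}$, $\mathbf{SUB}$ is complete in the frame class $\mathbb{SUB}$: if $[\![\varphi]\!]_{\mathfrak N}\subseteq[\![\psi]\!]_{\mathfrak N}$ for every SUB-model $\mathfrak N$ on every frame in $\mathbb{SUB}$, then $\varphi\vdash\psi$ is derivable in $\mathbf{SUB}$.
   Context: Frames. A frame is $\mathfrak F=(X,\perp,Y,R)$ with $X,Y$ nonempty sets, $\perp\subseteq X\times Y$, $R\subseteq X^3$ (write $xRzz'$). Let $I=(X\times Y)\setminus\perp$; standing assumption: each $x$ has some $y$ with $xIy$ and each $y$ has some $x$ with $xIy$. For $U\subseteq X$, $W\subseteq Y$: $U^\perp=\{y:\forall x\in U\,(x\perp y)\}$, ${}^\perp W=\{x:\forall y\in W\,(x\perp y)\}$; $A\subseteq X$ is stable if ${}^\perp(A^\perp)=A$. Preorder $x\preceq z$ iff $\{x\}^\perp\subseteq\{z\}^\perp$. Constraints: (C1) for all $w,z,u,v\in X$: $\exists x(xRuv\wedge zRxw)$ iff $\exists x(xRvw\wedge zRux)$; (C2) $xRzz'$ iff $xRz'z$; (C3) $xRzz'$ implies $z'\preceq x$; (C4) $xRxx$. Classes: $\mathbb{NFL}$ all frames; $\mathbb{FL}$: (C1); $\mathbb{BCI}$: (C1),(C2); $\mathbb{BCK}$: (C1),(C2),(C3); $\mathbb{BCW}$: (C1),(C2),(C4). Logics. Language: $\varphi::=p_i\mid\top\mid\bot\mid\varphi\wedge\varphi\mid\varphi\vee\varphi\mid\varphi\circ\varphi\mid\varphi\to\varphi\mid\varphi\leftarrow\varphi$.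 An NFL-algebra is a bounded lattice with binary operations $\circ,\to,\leftarrow$ such that $a\circ b\le c$ iff $b\le a\to c$ iff $a\le c\leftarrow b$; FL-algebra: plus $\circ$ associative; BCI-algebra: FL-algebra with $\circ$ commutative; BCK-algebra: BCI-algebra with $b\circ a\le a$; BCW-algebra: BCI-algebra with $a\wedge b\le a\circ b$. $\varphi\vdash\psi$ is derivable in $\mathbf{SUB}$ iff $v(\varphi)\le v(\psi)$ for every SUB-algebra and every valuation $v$ ($\top\mapsto1,\bot\mapsto0$). Models. $yR^\partial zz'$ iff for all $x\in X$, $xRzz'$ implies $x\perp y$. A SUB-model $\mathfrak N=(\mathfrak F,V)$ assigns a stable set $V(p_i)$ to each $p_i$; each $\varphi$ gets $[\![\varphi]\!]\subseteq X$, $(\!|\varphi|\!)\subseteq Y$ with $(\!|\varphi|\!)=[\![\varphi]\!]^\perp$, $[\![\varphi]\!]={}^\perp(\!|\varphi|\!)$, where: $[\![p_i]\!]=V(p_i)$; $[\![\top]\!]=X$; $(\!|\bot|\!)=Y$; $[\![\varphi\wedge\psi]\!]=[\![\varphi]\!]\cap[\![\psi]\!]$; $(\!|\varphi\vee\psi|\!)=(\!|\varphi|\!)\cap(\!|\psi|\!)$; $[\![\varphi\to\psi]\!]=\{x:\forall z\in X\,\forall y\in Y\,(z\in[\![\varphi]\!]\wedge y\in(\!|\psi|\!)\Rightarrow yR^\partial zx)\}$; $(\!|\varphi\circ\psi|\!)=\{y:\forall z,x\in X\,(z\in[\![\varphi]\!]\wedge x\in[\![\psi]\!]\Rightarrow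 yR^\partial zx)\}$; $[\![\psi\leftarrow\varphi]\!]=\{x:\forall y\in Y\,\forall z\in X\,(y\in(\!|\psi|\!)\wedge z\in[\![\varphi]\!]\Rightarrow yR^\partial xz)\}$. *)

(* Defs.v *)
From mathcomp Require Import all_boot all_order.
From mathcomp Require Import boolp classical_sets.

Set Implicit Arguments.
Unset Strict Implicit.
Unset Printing Implicit Defensive.

Local Open Scope classical_set_scope.

Inductive form : Type :=
| Var of nat
| Top
| Bot
| And of form & form
| Or of form & form
| Fus of form & form
| Imp of form & form
| Pmi of form & form. (* [Pmi psi phi] is psi <- phi: consequent first *)

Inductive logic : Type := NFL | FL | BCI | BCK | BCW.

(* Every type is classically a choiceType with boolean relations, so that
   bounded lattices are the [tbLatticeType]s.  In [nfl_pmi c b], as in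
   c <- b, the consequent comes first. *)
Record nfl_ops (d : Order.disp_t) (A : tbLatticeType d) : Type := NflOps {
  nfl_fus : A -> A -> A;
  nfl_imp : A -> A -> A;
  nfl_pmi : A -> A -> A;
  nfl_impP : forall a b c : A, (nfl_fus a b <= c)%O <-> (b <= nfl_imp a c)%O;
  nfl_pmiP : forall a b c : A, (nfl_fus a b <= c)%O <-> (a <= nfl_pmi c b)%O
}.

Section Algebras.
Variables (d : Order.disp_t) (A : tbLatticeType d) (N : nfl_ops A).
Local Notation "a ∘ b" := (nfl_fus N a b) (at level 40, left associativity).

Definition fus_assoc : Prop := forall a b c : A, (a ∘ b) ∘ c = a ∘ (b ∘ c).
Definition fus_comm : Prop := forall a b : A, a ∘ b = b ∘ a.
Definition fus_weak : Prop := forall a b : A, (b ∘ a <= a)%O.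
Definition fus_contr : Prop := forall a b : A, (Order.meet a b <= a ∘ b)%O.

Definition is_algebra (S : logic) : Prop :=
  match S with
  | NFL => True
  | FL => fus_assoc
  | BCI => fus_assoc /\ fus_comm
  | BCK => fus_assoc /\ fus_comm /\ fus_weak
  | BCW => fus_assoc /\ fus_comm /\ fus_contr
  end.

Fixpoint eval (v : nat -> A) (phi : form) : A :=
  match phi with
  | Var i => v i
  | Top => Order.top
  | Bot => Order.bottom
  | And p q => Order.meet (eval v p) (eval v q)
  | Or p q => Order.join (eval v p) (eval v q)
  | Fus p q => nfl_fus N (eval v p) (eval v q)
  | Imp p q => nfl_imp N (eval v p) (eval v q)
  | Pmi q p => nfl_pmi N (eval v q) (eval v p)
  end.

End Algebras.

Definition derivable (S : logic) (phi psi : form) : Prop :=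
  forall (d : Order.disp_t) (A : tbLatticeType d) (N : nfl_ops A),
    is_algebra N S ->
    forall v : nat -> A, (eval N v phi <= eval N v psi)%O.

(* [rel x z z'] is x R z z'. *)
Record frame : Type := Frame {
  wX : Type;
  wY : Type;
  perp : wX -> wY -> Prop;
  rel : wX -> wX -> wX -> Prop;
  wX_inh : inhabited wX;
  wY_inh : inhabited wY;
  perp_exX : forall x, exists y, ~ perp x y;
  perp_exY : forall y, exists x, ~ perp x y
}.

Section Frames.
Variable F : frame.

Definition rperp (U : set (wX F)) : set (wY F) :=
  [set y | forall x, U x -> perp x y].
Definition lperp (W : set (wY F)) : set (wX F) :=
  [set x | forall y, W y -> perp x y].
Definition stable (A : set (wX F)) : Prop := lperp (rperp A) = A.
Definition fle (x z : wX F) : Prop := rperp [set x] `<=` rperp [set z].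

Definition C1 : Prop := forall w z u v : wX F,
  (exists x, rel x u v /\ rel z x w) <-> (exists x, rel x v w /\ rel z u x).
Definition C2 : Prop := forall x z z' : wX F, rel x z z' <-> rel x z' z.
Definition C3 : Prop := forall x z z' : wX F, rel x z z' -> fle z' x.
Definition C4 : Prop := forall x : wX F, rel x x x.

Definition in_class (S : logic) : Prop :=
  match S with
  | NFL => True
  | FL => C1
  | BCI => C1 /\ C2
  | BCK => C1 /\ C2 /\ C3
  | BCW => C1 /\ C2 /\ C4
  end.

Definition drel (y : wY F) (z z' : wX F) : Prop :=
  forall x, rel x z z' -> perp x y.

Definition of_extent (U : set (wX F)) : set (wX F) * set (wY F) :=
  (U, rperp U).
Definition of_intent (W : set (wY F)) : set (wX F) * set (wY F) :=
  (lperp W, W).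

(* [(interp V phi).1] is [[phi]] and [(interp V phi).2] is (|phi|): each
   clause determines one of them, the other one being its polar. *)
Fixpoint interp (V : nat -> set (wX F)) (phi : form) :
    set (wX F) * set (wY F) :=
  match phi with
  | Var i => of_extent (V i)
  | Top => of_extent setT
  | Bot => of_intent setT
  | And p q => of_extent ((interp V p).1 `&` (interp V q).1)
  | Or p q => of_intent ((interp V p).2 `&` (interp V q).2)
  | Fus p q => of_intent [set y | forall z x,
      (interp V p).1 z -> (interp V q).1 x -> drel y z x]
  | Imp p q => of_extent [set x | forall z y,
      (interp V p).1 z -> (interp V q).2 y -> drel y z x]
  | Pmi q p => of_extent [set x | forall y z,
      (interp V q).2 y -> (interp V p).1 z -> drel y x z]
  end.

(* A frame need not make the sets defined by the clauses for -> and <-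
   stable, so the requirement that [[phi]] and (|phi|) are the polars of each
   other is a genuine condition on models. *)
Record model : Type := Model {
  val : nat -> set (wX F);
  val_stable : forall i, stable (val i);
  interp_galois : forall phi,
    (interp val phi).2 = rperp (interp val phi).1 /\
    (interp val phi).1 = lperp (interp val phi).2
}.

Definition den (M : model) (phi : form) : set (wX F) :=
  (interp (val M) phi).1.
Definition coden (M : model) (phi : form) : set (wY F) :=
  (interp (val M) phi).2.

End Frames.

(* Main.v *)
Require Import Defs.
From mathcomp Require Import all_boot all_order.
From mathcomp Require Import boolp classical_sets.

(** In a nontrivial algebra take for points the proper filters, for
    co-points the proper ideals, let [x] be orthogonal to [y] when they meet,
    and let [x R z z'] mean that [x] contains all products of [z] and [z'].
    Interpreting each variable by the filters containing its value, every
    formula is interpreted by the filters, and the ideals, containing its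
    value; so if the value of [phi] is not 0, the principal filter that it
    generates belongs to [[psi]], which says that the value of [psi] is above
    it.  No prime filters are needed. *)

Set Implicit Arguments.
Unset Strict Implicit.
Unset Printing Implicit Defensive.

Import Order.Theory.

Local Open Scope classical_set_scope.

(** * Consequences of residuation *)

Section NflOpsTheory.
Context {d : Order.disp_t} {A : tbLatticeType d} (N : nfl_ops A).
Local Open Scope order_scope.
Local Notation "a ∘ b" := (nfl_fus N a b) (at level 40, left associativity).

Lemma fus_mono (a a' b b' : A) : a <= a' -> b <= b' -> a ∘ b <= a' ∘ b'.
Proof.
move=> aa' bb'; apply/nfl_impP/(le_trans bb')/nfl_impP/nfl_pmiP.
by apply: (le_trans aa'); apply/nfl_pmiP.
Qed.

Lemma fus0x (a : A) : \bot ∘ a = \bot.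
Proof. by apply/eqP; rewrite -lex0; apply/nfl_pmiP; apply: le0x. Qed.

Lemma fusx0 (a : A) : a ∘ \bot = \bot.
Proof. by apply/eqP; rewrite -lex0; apply/nfl_impP; apply: le0x. Qed.

Lemma fus_imp_le (a b : A) : a ∘ nfl_imp N a b <= b.
Proof. by apply/nfl_impP. Qed.

Lemma fus_pmi_le (a b : A) : nfl_pmi N b a ∘ a <= b.
Proof. by apply/nfl_pmiP. Qed.

End NflOpsTheory.

(** * Proper filters and proper ideals *)

Section FiltersIdeals.
Context {d : Order.disp_t} {A : tbLatticeType d}.
Local Open Scope order_scope.

(** Properness secures the standing assumption on frames: a filter with [\bot] would meet every
    ideal. Ideals are treated dually. *)
Record proper_filter : Type := ProperFilter {
  fil_set :> A -> Prop;
  fil_top : fil_set \top;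
  fil_bot : ~ fil_set \bot;
  fil_le : forall a b : A, a <= b -> fil_set a -> fil_set b;
  fil_meet : forall a b : A, fil_set a -> fil_set b -> fil_set (a `&` b)
}.

Record proper_ideal : Type := ProperIdeal {
  idl_set :> A -> Prop;
  idl_bot : idl_set \bot;
  idl_top : ~ idl_set \top;
  idl_le : forall a b : A, a <= b -> idl_set b -> idl_set a;
  idl_join : forall a b : A, idl_set a -> idl_set b -> idl_set (a `|` b)
}.

Definition up_filter (a : A) (a0 : a <> \bot) : proper_filter.
Proof.
refine (@ProperFilter (fun b => a <= b) _ _ _ _) => /=.
- exact: lex1.
- by rewrite lex0 => /eqP.
- by move=> b c bc ab; apply: le_trans bc.
- by move=> b c ab ac; rewrite lexI ab.
Defined.

Definition down_ideal (a : A) (a1 : a <> \top) : proper_ideal.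
Proof.
refine (@ProperIdeal (fun b => b <= a) _ _ _ _) => /=.
- exact: le0x.
- by rewrite le1x => /eqP.
- by move=> b c bc ca; apply: le_trans ca.
- by move=> b c ba ca; rewrite leUx ba.
Defined.

Definition meets (x : proper_filter) (y : proper_ideal) : Prop :=
  exists a, x a /\ y a.

Definition containing_filters (a : A) : set proper_filter := [set x : proper_filter | x a].
Definition containing_ideals (a : A) : set proper_ideal := [set y : proper_ideal | y a].

End FiltersIdeals.
Arguments proper_filter {d} A.
Arguments proper_ideal {d} A.
Arguments fil_top {d A} x : rename.
Arguments fil_bot {d A} x : rename.
Arguments fil_le {d A} x {a b} : rename.
Arguments fil_meet {d A} x {a b} : rename.
Arguments idl_bot {d A} y : rename.
Arguments idl_top {d A} y : rename.
Arguments idl_le {d A} y {a b} : rename.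
Arguments idl_join {d A} y {a b} : rename.

(** * The canonical frame and its constraints *)

Section CanonicalFrame.
Context {d : Order.disp_t} {A : tbLatticeType d} (N : nfl_ops A).
Hypothesis nontrivial : \bot%O <> \top%O :> A.
Local Open Scope order_scope.
Local Notation "a ∘ b" := (nfl_fus N a b) (at level 40, left associativity).

Definition fus_rel (x u v : proper_filter A) : Prop :=
  forall a b, u a -> v b -> x (a ∘ b).

(** The least point [x] with [fus_rel x u v]: the upward closure of the products, with [uv0]
    expressing its properness. *)
Definition fus_filter (u v : proper_filter A)
  (uv0 : forall a b, u a -> v b -> a ∘ b <> \bot) : proper_filter A.
Proof.
refine (@ProperFilter _ _
  (fun c => exists a b, [/\ u a, v b & a ∘ b <= c]) _ _ _ _) => /=.
- by exists \top, \top; split; [exact: fil_top|exact: fil_top|exact: lex1].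
- by move=> [a [b [ua vb]]]; rewrite lex0 => /eqP; apply: uv0.
- move=> c c' cc' [a [b [ua vb abc]]]; exists a, b; split=> //.
  exact: le_trans cc'.
- move=> c c' [a [b [ua vb abc]]] [a' [b' [ua' vb' abc']]].
  exists (a `&` a'), (b `&` b'); split; try exact: fil_meet.
  rewrite lexI; apply/andP; split.
    by apply: le_trans abc; apply: fus_mono; apply: leIl.
  by apply: le_trans abc'; apply: fus_mono; apply: leIr.
Defined.

Lemma fus_filter_rel u v uv0 : fus_rel (@fus_filter u v uv0) u v.
Proof. by move=> a b ua vb; exists a, b. Qed.

(** The ideal with sole element [\bot] meets no proper filter; dually for the filter with sole
    element [\top] in [meets_exY]. *)
Lemma meets_exX (x : proper_filter A) : exists y : proper_ideal A, ~ meets x y.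
Proof.
exists (down_ideal nontrivial) => -[a [xa /= a0]].
exact: (fil_bot x (fil_le x a0 xa)).
Qed.

Lemma meets_exY (y : proper_ideal A) : exists x : proper_filter A, ~ meets x y.
Proof.
exists (up_filter (nesym nontrivial)) => -[a [/= a1 ya]].
exact: (idl_top y (idl_le y a1 ya)).
Qed.

Definition canonical_frame : frame :=
  @Frame (proper_filter A) (proper_ideal A) meets fus_rel
    (inhabits (up_filter (nesym nontrivial)))
    (inhabits (down_ideal nontrivial)) meets_exX meets_exY.

(** The required intermediate point is the product filter of the other pair; its properness is
    inherited from [z]. *)
Lemma canonical_C1 : fus_assoc N -> C1 canonical_frame.
Proof.
move=> fusA w z u v; split=> -[/= x [xR zR]].
(* [z] contains [(\top ∘ b) ∘ c], which by associativity is [\bot] as soon as [b ∘ c] is. *)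
- have vw0 b c : v b -> w c -> b ∘ c <> \bot.
    move=> vb wc bc0; apply: (fil_bot z).
    have := zR _ _ (xR _ _ (fil_top u) vb) wc.
    by rewrite fusA bc0 fusx0.
  exists (fus_filter vw0); split; first exact: fus_filter_rel.
  move=> a e ua [b [c [vb wc bce]]].
  apply: (@fil_le _ _ z (a ∘ (b ∘ c))); first exact: fus_mono.
  by rewrite -fusA; apply: zR => //; apply: xR.
- have uv0 a b : u a -> v b -> a ∘ b <> \bot.
    move=> ua vb ab0; apply: (fil_bot z).
    have := zR _ _ ua (xR _ _ vb (fil_top w)).
    by rewrite -fusA ab0 fus0x.
  exists (fus_filter uv0); split; first exact: fus_filter_rel.
  move=> e c [a [b [ua vb abe]]] wc.
  apply: (@fil_le _ _ z (a ∘ b ∘ c)); first exact: fus_mono.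
  by rewrite fusA; apply: zR => //; apply: xR.
Qed.

Lemma canonical_C2 : fus_comm N -> C2 canonical_frame.
Proof.
by move=> fusC x z z'; split=> /= xR a b za zb; rewrite fusC; apply: xR.
Qed.

(** If [a] is in [z'], then [x] contains [\top ∘ a], hence [a] by weakening; so an ideal meeting
    [z'] also meets [x]. *)
Lemma canonical_C3 : fus_weak N -> C3 canonical_frame.
Proof.
move=> fusW x z z' /= xR y yz' _ -> /=.
have [a [z'a ya]] := yz' z' erefl; exists a; split=> //.
exact: (fil_le _ (fusW a \top) (xR _ _ (fil_top z) z'a)).
Qed.

Lemma canonical_C4 : fus_contr N -> C4 canonical_frame.
Proof.
by move=> fusI x a b xa xb; apply: (fil_le x (fusI a b)); apply: fil_meet.
Qed.

Lemma canonical_in_class S : is_algebra N S -> in_class canonical_frame S.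
Proof.
case: S => //=.
- exact: canonical_C1.
- by move=> [hA hC]; split; [exact: canonical_C1|exact: canonical_C2].
- move=> [hA [hC hW]].
  by split; [exact: canonical_C1|split; [exact: canonical_C2|exact: canonical_C3]].
- move=> [hA [hC hI]].
  by split; [exact: canonical_C1|split; [exact: canonical_C2|exact: canonical_C4]].
Qed.

(** * Interpretation of formulas in the canonical frame *)

Local Notation ext a := (containing_filters a : set (wX canonical_frame)).
Local Notation int a := (containing_ideals a : set (wY canonical_frame)).

(** Testing an ideal against the principal filter of [a] suffices. For [a = \bot] that filter is not
    proper, but every ideal contains [\bot]. *)
Lemma rperp_containing (a : A) : rperp (ext a) = int a.
Proof.
apply/seteqP; split=> /= y; last by move=> ya x xa; exists a.
move=> ay; have [->|/eqP a0] := eqVneq a \bot; first exact: idl_bot.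
have [b [/= ab yb]] := ay (up_filter a0) (lexx a).
exact: (idl_le y ab yb).
Qed.

Lemma lperp_containing (a : A) : lperp (int a) = ext a.
Proof.
apply/seteqP; split=> /= x; last by move=> xa y ya; exists a.
move=> ax; have [->|/eqP a1] := eqVneq a \top; first exact: fil_top.
have [b [xb /= ba]] := ax (down_ideal a1) (lexx a).
exact: (fil_le x ba xb).
Qed.

Lemma containing_top : [set: wX canonical_frame] = ext \top.
Proof. by apply/seteqP; split=> // x _; apply: fil_top. Qed.

Lemma containing_bot : [set: wY canonical_frame] = int \bot.
Proof. by apply/seteqP; split=> // y _; apply: idl_bot. Qed.

Lemma containing_meet (a b : A) : ext a `&` ext b = ext (a `&` b).
Proof.
apply/seteqP; split=> x /=; first by move=> [xa xb]; apply: fil_meet.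
by move=> xab; split; apply: fil_le xab; [exact: leIl|exact: leIr].
Qed.

Lemma containing_join (a b : A) : int a `&` int b = int (a `|` b).
Proof.
apply/seteqP; split=> y /=; first by move=> [ya yb]; apply: idl_join.
by move=> yab; split; apply: idl_le yab; [exact: leUl|exact: leUr].
Qed.

Lemma containing_fus (a b : A) :
  [set y | forall z x, ext a z -> ext b x -> drel y z x] = int (a ∘ b).
Proof.
apply/seteqP; split=> /= y; last first.
  by move=> yab z x za xb x' x'R; exists (a ∘ b); split=> //; apply: x'R.
move=> yab; have [->|/eqP ab0] := eqVneq (a ∘ b) \bot; first exact: idl_bot.
have a0 : a <> \bot by move=> a0; apply: ab0; rewrite a0 fus0x.
have b0 : b <> \bot by move=> b0; apply: ab0; rewrite b0 fusx0.
(* Three principal filters suffice as test points; monotonicity relates them. *)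
have abR : fus_rel (up_filter ab0) (up_filter a0) (up_filter b0).
  by move=> a' b'; apply: fus_mono.
have [c [/= abc yc]] := yab (up_filter a0) (up_filter b0) (lexx a) (lexx b) _ abR.
exact: (idl_le y abc yc).
Qed.

(** If [x] lacks the residual, the product of the principal filter of [a] with [x] is a proper
    filter disjoint from the principal ideal of [b], so it refutes the clause for [->]. *)
Lemma containing_imp (a b : A) :
  [set x | forall z y, ext a z -> int b y -> drel y z x] =
  ext (nfl_imp N a b).
Proof.
apply/seteqP; split=> /= x; last first.
  move=> xab z y za yb x' x'R; exists b; split=> //.
  exact: (fil_le _ (fus_imp_le N a b) (x'R _ _ za xab)).
move=> xab; apply: contrapT => xNab.
(* This gives the disjointness and also excludes the degenerate cases: [a = \bot], [b = \top] or an
   improper product filter would each put some such [e ∘ c] below [b]. *)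
have xNle c e : x c -> a <= e -> ~ (e ∘ c <= b).
  move=> xc ae /(le_trans (fus_mono N ae (lexx c))) /nfl_impP cab.
  exact: xNab (fil_le x cab xc).
have a0 : a <> \bot.
  move=> a0; apply: (xNle \top a (fil_top x) (lexx a)).
  by rewrite a0 fus0x le0x.
have b1 : b <> \top.
  by move=> b1; apply: (xNle \top a (fil_top x) (lexx a)); rewrite b1 lex1.
have ax0 e c : up_filter a0 e -> x c -> e ∘ c <> \bot.
  by move=> ae xc ec0; apply: (xNle c e xc ae); rewrite ec0 le0x.
have [c [[e [f [ae xf efc]]] /= cb]] :=
  xab (up_filter a0) (down_ideal b1) (lexx a) (lexx b) _ (@fus_filter_rel _ _ ax0).
exact: xNle xf ae (le_trans efc cb).
Qed.

(** The mirror image of [containing_imp], with [x] as the left factor. *)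
Lemma containing_pmi (a b : A) :
  [set x | forall y z, int b y -> ext a z -> drel y x z] =
  ext (nfl_pmi N b a).
Proof.
apply/seteqP; split=> /= x; last first.
  move=> xab y z yb za x' x'R; exists b; split=> //.
  exact: (fil_le _ (fus_pmi_le N a b) (x'R _ _ xab za)).
move=> xab; apply: contrapT => xNab.
have xNle c e : x c -> a <= e -> ~ (c ∘ e <= b).
  move=> xc ae /(le_trans (fus_mono N (lexx c) ae)) /nfl_pmiP cab.
  exact: xNab (fil_le x cab xc).
have a0 : a <> \bot.
  move=> a0; apply: (xNle \top a (fil_top x) (lexx a)).
  by rewrite a0 fusx0 le0x.
have b1 : b <> \top.
  by move=> b1; apply: (xNle \top a (fil_top x) (lexx a)); rewrite b1 lex1.
have xa0 c e : x c -> up_filter a0 e -> c ∘ e <> \bot.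
  by move=> xc ae ec0; apply: (xNle c e xc ae); rewrite ec0 le0x.
have [c [[f [e [xf ae fec]]] /= cb]] :=
  xab (down_ideal b1) (up_filter a0) (lexx b) (lexx a) _ (@fus_filter_rel _ _ xa0).
exact: xNle xf ae (le_trans fec cb).
Qed.

(** The truth lemma, for both components at once: each clause computes one of them, and its polar is
    the other. *)
Lemma canonical_interp (v : nat -> A) (phi : form) :
  interp (fun i => ext (v i)) phi = (ext (eval N v phi), int (eval N v phi)).
Proof.
have extE (a : A) : of_extent (ext a) = (ext a, int a).
  by rewrite /of_extent rperp_containing.
have intE (a : A) : of_intent (int a) = (ext a, int a).
  by rewrite /of_intent lperp_containing.
elim: phi => [i|||p IHp q IHq|p IHp q IHq|p IHp q IHq|p IHp q IHq|q IHq p IHp]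
  /=; rewrite ?IHp ?IHq /=.
- exact: extE.
- by rewrite containing_top extE.
- by rewrite containing_bot intE.
- by rewrite -extE -containing_meet.
- by rewrite -intE -containing_join.
- by rewrite -intE -containing_fus.
- by rewrite -extE -containing_imp.
- by rewrite -extE -containing_pmi.
Qed.

Definition canonical_model (v : nat -> A) : model canonical_frame.
Proof.
refine (@Model canonical_frame (fun i => ext (v i)) _ _).
- by move=> i; rewrite /stable rperp_containing lperp_containing.
- by move=> phi; rewrite canonical_interp /= rperp_containing lperp_containing.
Defined.

Lemma canonical_den (v : nat -> A) (phi : form) :
  den (canonical_model v) phi = ext (eval N v phi).
Proof. by rewrite /den canonical_interp. Qed.

End CanonicalFrame.

Theorem theorem4p2 (S : logic) (phi psi : form)
    (valid : forall F : frame, in_class F S ->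
       forall M : model F, den M phi `<=` den M psi) :
  derivable S phi psi.
Proof.
move=> d A N algN v.
(* The value [\bot] generates no proper filter, but is below everything. Any other value also forces
   the algebra to be nontrivial. *)
have [phi0|/eqP phi0] := eqVneq (eval N v phi) \bot%O.
  by rewrite phi0 le0x.
have nontrivial : \bot%O <> \top%O :> A.
  move=> A01; apply: phi0; apply/eqP.
  by rewrite -lex0 A01 lex1.
have := valid _ (canonical_in_class nontrivial algN)
  (canonical_model N nontrivial v).
rewrite !canonical_den => /(_ (up_filter phi0)); apply.
exact: lexx.
Qed.
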